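(* Let $S$ be a left ample semigroup. Then $S\theta_S$ is a left I-order in its inverse hull $\Sigma(S)$ if and only if $S$ has Condition (LC). If Condition (LC) holds, then $S\theta_S$ is a union of $\mathcal{R}^{\Sigma(S)}$-classes.
   Context: For a semigroup $S$, the relation $\mathcal{R}^*$ is defined by: $a\,\mathcal{R}^*\,b$ if and only if for all $x,y\in S^1$, $xa=ya\Leftrightarrow xb=yb$. A semigroup $S$ is left ample if its set of idempotents $E(S)$ is a semilattice (idempotents commute), every $\mathcal{R}^*$-class contains a (necessarily unique) idempotent, the one in the class of $a$ being denoted $a^+$, and $xy^+=(xy^+)^+x$ for all $x,y\in S$. Let $S$ be left ample and $\mathcal{I}_S$ the symmetric inverse semigroup on $S$ (partial one-one maps, written on the right and composed left to right). For $a\in S$ let $\rho_a\in\mathcal{I}_S$ have domain $Sa^+$ and image $Sa$, with $x\rho_a=xa$. The map $\theta_S:S\to\mathcal{I}_S$, $a\mapsto\rho_a$, is an embedding (with $\rho_{a^+}=\rho_a\rho_a^{-1}$). The inverse hull $\Sigma(S)$ is the inverse subsemigroup of $\mathcal{I}_S$ generated by $S\theta_S$. $\mathcal{R}^{\Sigma(S)}$ is Green's relation $\mathcal{R}$ on $\Sigma(S)$. A subsemigroup $S$ of an inverse semigroup $Q$ is a left I-order in $Q$ if every $q\in Q$ can be written as $q=a^{-1}b$ with $a,b\in S$ ($a^{-1}$ the inverse of $a$ in the inverse semigroup $Q$). A semigroup $S$ satisfies Condition (LC) if for any $a,b\in S$ there exists $c\in S$ with $Sa\cap Sb=Sc$.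 *)

(* Defs.v *)
From HB Require Import structures.
From mathcomp Require Import all_boot.
From mathcomp Require Import boolp classical_sets.

Set Implicit Arguments.
Unset Strict Implicit.
Unset Printing Implicit Defensive.

Local Open Scope classical_set_scope.
Local Open Scope group_scope.

Section Semigroups.
Variable S : semigroupType.
Implicit Types (a b x y : S) (A : set S).

(* S^1 is represented by option S, None being the adjoined identity; it is only
   used through its left and right actions on S, so that adjoining an identity
   when S already has one makes no difference. *)
Definition lmul1 (x : option S) a := if x is Some s then s * a else a.
Definition rmul1 a (x : option S) := if x is Some s then a * s else a.

Definition Rstar a b :=
  forall x y : option S, lmul1 x a = lmul1 y a <-> lmul1 x b = lmul1 y b.

Definition idem a := a * a = a.

(* The idempotent in the R*-class of a: it is unique when idempotents commute,
   and it takes the junk value a if there is none. *)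
Definition plus a := xget a [set e | idem e /\ Rstar a e].

Definition left_ample :=
  [/\ forall e f : S, idem e -> idem f -> e * f = f * e,
      forall a, exists e, idem e /\ Rstar a e &
      forall x y, x * plus y = plus (x * plus y) * x].

(* Sa, not S^1 a *)
Definition lideal a := [set x * a | x in [set: S]].

Definition LC := forall a b, exists c, lideal a `&` lideal b = lideal c.

Definition green_R a b := range (rmul1 a) = range (rmul1 b).

Definition R_classes := [set [set b | green_R a b] | a in [set: S]].

Definition union_of_R_classes A :=
  exists2 C : set (set S), C `<=` R_classes & A = \bigcup_(X in C) X.

Definition subsemigroup A := forall a b, A a -> A b -> A (a * b).

End Semigroups.

HB.mixin Record Semigroup_isInverse Q of Semigroup Q := {
  sinv : Q -> Q;
  sinvP : forall a b : Q, (a * b * a = a /\ b * a * b = b) <-> b = sinv a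
}.

#[short(type="inverseSemigroupType")]
HB.structure Definition InverseSemigroup :=
  { Q of Semigroup_isInverse Q & Semigroup Q }.

Definition left_I_order (Q : inverseSemigroupType) (A : set Q) :=
  subsemigroup A /\
  forall q : Q, exists a b : Q, [/\ A a, A b & q = sinv a * b].

Section Generated.
Variable Q : inverseSemigroupType.

Definition inverse_subsemigroup (A : set Q) :=
  subsemigroup A /\ forall a, A a -> A (sinv a).

Definition invgen (G : set Q) : set Q := smallest inverse_subsemigroup G.

Variable G : set Q.

Lemma sub_invgen : G `<=` invgen G.
Proof. by move=> x Gx A [_ GA]; apply: GA. Qed.

Lemma invgenM x y : invgen G x -> invgen G y -> invgen G (x * y).
Proof. by move=> Gx Gy A HA; case: (HA) => -[AM _] _; apply: AM; [apply: Gx|apply: Gy]. Qed.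

Lemma invgenV x : invgen G x -> invgen G (sinv x).
Proof. by move=> Gx A HA; case: (HA) => -[_ AV] _; apply: AV; apply: Gx. Qed.

(* The inverse subsemigroup generated by G, as an inverse semigroup of its own *)
Record invgen_type := InvGen { invgen_val : Q; invgen_valP : invgen G invgen_val }.

HB.instance Definition _ := gen_eqMixin invgen_type.
HB.instance Definition _ := gen_choiceMixin invgen_type.

Lemma invgen_val_inj : injective invgen_val.
Proof.
by case=> x Hx [y Hy] /= e; case: _ / e Hy => Hy; congr InvGen; apply: Prop_irrelevance.
Qed.

Definition invgen_mul (p q : invgen_type) :=
  InvGen (invgenM (invgen_valP p) (invgen_valP q)).
Definition invgen_inv (p : invgen_type) := InvGen (invgenV (invgen_valP p)).

Lemma invgen_mulA : associative invgen_mul.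
Proof. by move=> p q r; apply: invgen_val_inj; rewrite /= mulgA. Qed.

HB.instance Definition _ := isSemigroup.Build invgen_type invgen_mulA.

Lemma invgen_invP (p q : invgen_type) :
  (p * q * p = p /\ q * p * q = q) <-> q = invgen_inv p.
Proof.
split=> [[/(congr1 invgen_val) /= h1 /(congr1 invgen_val) /= h2]|->].
  by apply: invgen_val_inj => /=; apply/sinvP.
have /sinvP[h1 h2] : sinv (invgen_val p) = sinv (invgen_val p) by [].
by split; apply: invgen_val_inj.
Qed.

HB.instance Definition _ := Semigroup_isInverse.Build invgen_type invgen_invP.

End Generated.

(* The symmetric inverse semigroup: a partial one-one map f is given by its
   graph, pgraph f x y meaning that x lies in the domain of f and x f = y. *)
Section SymmetricInverse.
Variable T : Type.

Record sym_inv := SymInv {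
  pgraph : T -> T -> Prop;
  pgraph_fun : forall x y y', pgraph x y -> pgraph x y' -> y = y';
  pgraph_inj : forall x x' y, pgraph x y -> pgraph x' y -> x = x'
}.

HB.instance Definition _ := gen_eqMixin sym_inv.
HB.instance Definition _ := gen_choiceMixin sym_inv.

Lemma sym_invP (f g : sym_inv) :
  (forall x y, pgraph f x y <-> pgraph g x y) -> f = g.
Proof.
case: f g => [f f1 f2] [g g1 g2] /= fg.
have e : f = g by apply/funext => x; apply/funext => y; apply/propext.
by case: _ / e g1 g2 {fg} => g1 g2; congr SymInv; apply: Prop_irrelevance.
Qed.

(* composition from left to right: x (f g) = (x f) g *)
Definition mul_graph (f g : sym_inv) x z :=
  exists2 y, pgraph f x y & pgraph g y z.

Lemma mul_graph_fun f g x z z' :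
  mul_graph f g x z -> mul_graph f g x z' -> z = z'.
Proof.
move=> [y fy gz] [y' fy' gz'].
by move: gz'; rewrite -(pgraph_fun fy fy'); apply: pgraph_fun gz.
Qed.

Lemma mul_graph_inj f g x x' z :
  mul_graph f g x z -> mul_graph f g x' z -> x = x'.
Proof.
move=> [y fy gz] [y' fy' gz'].
by move: fy'; rewrite -(pgraph_inj gz gz'); apply: pgraph_inj fy.
Qed.

Definition sym_mul f g := SymInv (@mul_graph_fun f g) (@mul_graph_inj f g).

Definition sym_V (f : sym_inv) := @SymInv (fun x y => pgraph f y x)
  (fun x y y' => @pgraph_inj f y y' x) (fun x x' y => @pgraph_fun f y x x').

Lemma sym_mulA : associative sym_mul.
Proof.
move=> f g h; apply: sym_invP => x y /=; split.
  by move=> [z fz [t gt ht]]; exists t => //; exists z.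
by move=> [t [z fz gt] ht]; exists z => //; exists t.
Qed.

HB.instance Definition _ := isSemigroup.Build sym_inv sym_mulA.

Lemma sym_VP (f g : sym_inv) :
  (f * g * f = f /\ g * f * g = g) <-> g = sym_V f.
Proof.
have sub (h k : sym_inv) : h * k * h = h ->
    forall x y, pgraph h x y -> pgraph k y x.
  move=> e x y hxy; have := hxy; rewrite -{1}e => -[x' [y' hxy' kyx] hxy2].
  by move: kyx; rewrite -(pgraph_inj hxy hxy2) -(pgraph_fun hxy hxy').
have reg (h : sym_inv) : h * sym_V h * h = h.
  apply: sym_invP => x y; split=> [[x' [y' h1 /= h2] h3]|hxy].
    by move: h3; rewrite (pgraph_inj h2 h1).
  by exists x => //; exists y.
split=> [[e1 e2]|->].
  by apply: sym_invP => x y; split; [apply: (sub g f e2)|apply: (sub f g e1)].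
have VK : sym_V (sym_V f) = f by apply: sym_invP.
by split; last have := reg (sym_V f); rewrite ?VK.
Qed.

HB.instance Definition _ := Semigroup_isInverse.Build sym_inv sym_VP.

End SymmetricInverse.

Section InverseHull.
Variables (S : semigroupType) (hS : left_ample S).

Lemma plus_spec (a : S) : idem (plus a) /\ Rstar a (plus a).
Proof. by case: hS => _ /(_ a) exa _; apply: (xgetPex a exa). Qed.

Definition rho_graph (a x y : S) := lideal (plus a) x /\ y = x * a.

Lemma rho_graph_fun a x y y' : rho_graph a x y -> rho_graph a x y' -> y = y'.
Proof. by move=> [_ ->] [_ ->]. Qed.

Lemma rho_graph_inj a x x' y : rho_graph a x y -> rho_graph a x' y -> x = x'.
Proof.
move=> [[s _ <-] ->] [[t _ <-]].
have [ie /(_ (Some (s * plus a)) (Some (t * plus a))) [/= h _]] := plus_spec a.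
by move=> /h; rewrite -!mulgA ie.
Qed.

Definition rho (a : S) : sym_inv S :=
  SymInv (@rho_graph_fun a) (@rho_graph_inj a).

Definition inverse_hull : inverseSemigroupType := invgen_type (range rho).

Definition theta (a : S) : inverse_hull :=
  InvGen (sub_invgen (imageT rho a)).

End InverseHull.

(* Main.v *)
Require Import Defs.
From mathcomp Require Import all_boot.
From mathcomp Require Import boolp classical_sets.

(** The inverse hull consists of partial one-one maps that commute with left
    translations of S, and both parts of the theorem are read off from graphs.

    That [theta] is multiplicative ([rhoM]) comes down to the fact that x
    lies in S(ab)^+ exactly when x lies in Sa^+ and xa lies in Sb^+, which is
    where the identity a b^+ = (ab)^+ a of left ample semigroups is used
    ([mul_plusE]).

    The map rho_a rho_b^-1 sends x to y when xa = yb, so it parametrizes the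
    intersection of Sa and Sb, while rho_s^-1 rho_t sends zs to zt.  If the
    intersection is Sw, with w = sa = tb, s in Sa^+ and t in Sb^+, then the
    two maps coincide ([rho_div_swap]); hence the left quotients rho_a^-1 rho_b
    are closed under products and fill the hull ([hull_quotient]).  Conversely,
    if rho_a rho_b^-1 is rho_c^-1 rho_d, then its graph is the set of pairs
    (zc, zd) with z in Se, where e = c^+ d^+, and the intersection of Sa and Sb
    is Seca ([LC_of_left_I_order]).

    Finally, let f in the hull be R-related to rho_a.  Its domain is Sa^+, and
    since f commutes with left translations it is determined by b = a^+ f: it
    sends x to xb.  As f is one-one, b is R*-related to a^+, and f = rho_b
    ([green_R_theta]). *)

Set Implicit Arguments.
Unset Strict Implicit.
Unset Printing Implicit Defensive.

Local Open Scope classical_set_scope.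
Local Open Scope group_scope.

Lemma sym_inv_sinvM (T : Type) (f g : sym_inv T) :
  sinv (f * g) = sinv g * sinv f.
Proof. by apply: sym_invP => x y; split=> -[z h1 h2]; exists z. Qed.

Lemma sym_inv_sinvK (T : Type) (f : sym_inv T) : sinv (sinv f) = f.
Proof. exact: sym_invP. Qed.

Section LeftAmple.
Variables (S : semigroupType) (hS : left_ample S).
Implicit Types (a b c d e s t w x y z : S).

Lemma idem_plus a : idem (plus a).
Proof. by case: (plus_spec hS a). Qed.

Lemma Rstar_plus a : Rstar a (plus a).
Proof. by case: (plus_spec hS a). Qed.

Lemma plusC a b : plus a * plus b = plus b * plus a.
Proof. by case: hS => comm _ _; apply: comm; apply: idem_plus. Qed.

Lemma plus_mul a : plus a * a = a.
Proof. exact/(Rstar_plus a (Some (plus a)) None)/idem_plus. Qed.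

(** Two R*-related idempotents absorb one another, so they agree once they
    commute. *)
Lemma plus_eq a e : idem e -> Rstar a e -> plus a = e.
Proof.
move=> ie Rae; have ip := idem_plus a; have Rp := Rstar_plus a.
have pe : plus a * e = e by apply/(Rae (Some (plus a)) None)/Rp.
have ep : e * plus a = plus a by apply/(Rp (Some e) None)/Rae.
by case: hS => comm _ _; rewrite -ep -[RHS]pe comm.
Qed.

(** R* is a left congruence, so b R* b^+ may be multiplied by a. *)
Lemma plus_mulr a b : plus (a * plus b) = plus (a * b).
Proof.
apply: plus_eq; first exact: idem_plus.
move=> x y; have Rab := Rstar_plus (a * b) x y.
have := Rstar_plus b (Some (if x is Some s then s * a else a))
                     (Some (if y is Some s then s * a else a)).
by case: x y Rab => [x|] [y|] /= Rab; rewrite -?mulgA => Rb; tauto.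
Qed.

Lemma mul_plusE a b : a * plus b = plus (a * b) * a.
Proof. by case: hS => _ _ ->; rewrite plus_mulr. Qed.

(** Since a^+ fixes a on the left, it fixes ab, hence also (ab)^+. *)
Lemma plus_mull a b : plus (a * b) * plus a = plus (a * b).
Proof.
rewrite plusC; apply/(Rstar_plus (a * b) (Some (plus a)) None).
by rewrite /= mulgA plus_mul.
Qed.

Lemma lideal_plus a x : lideal (plus a) x <-> x * plus a = x.
Proof.
split=> [[s _ <-]|<-]; last by exists x.
by rewrite -mulgA idem_plus.
Qed.

Lemma rhoE a x y : pgraph (rho hS a) x y <-> x * plus a = x /\ y = x * a.
Proof. by rewrite /= /rho_graph lideal_plus. Qed.

Lemma mulr_plus_inj a x y :
  x * plus a = x -> y * plus a = y -> x * a = y * a -> x = y.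
Proof. by move=> hx hy /(Rstar_plus a (Some x) (Some y)) /=; rewrite hx hy. Qed.

Lemma dom_mul a b x :
  x * plus (a * b) = x <-> x * plus a = x /\ x * a * plus b = x * a.
Proof.
split=> [h|[h1 h2]].
  split; first by rewrite -h -mulgA plus_mull.
  by rewrite -mulgA mul_plusE mulgA h.
apply: (@mulr_plus_inj a) => //; first by rewrite -mulgA plus_mull.
by rewrite -mulgA -mul_plusE mulgA.
Qed.

Lemma rhoM a b : rho hS (a * b) = rho hS a * rho hS b.
Proof.
apply: sym_invP => x y; rewrite rhoE dom_mul; split.
  move=> [[h1 h2] ->]; exists (x * a); first exact/rhoE.
  by apply/rhoE; rewrite mulgA.
move=> [z /rhoE[h1 ->] /rhoE[h2 ->]].
by rewrite mulgA.
Qed.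

Lemma rho_left_quotE a b x y :
  pgraph (sinv (rho hS a) * rho hS b) x y <->
  exists z, [/\ z * plus a = z, z * plus b = z, x = z * a & y = z * b].
Proof.
split=> [[z /rhoE[h1 h2] /rhoE[h3 h4]]|[z [h1 h2 h3 h4]]]; exists z => //.
  exact/rhoE.
exact/rhoE.
Qed.

Lemma rho_right_quotE a b x y :
  pgraph (rho hS a * sinv (rho hS b)) x y <->
  [/\ x * plus a = x, y * plus b = y & x * a = y * b].
Proof.
split=> [[z /rhoE[h1 ->] /rhoE[h2 h3]] //|[h1 h2 h3]].
exists (x * a); apply/rhoE; first by [].
by split.
Qed.

Lemma lideal_domP b w : lideal b w -> exists2 s, s * plus b = s & s * b = w.
Proof.
move=> [s _ <-]; exists (s * plus b); first by rewrite -mulgA idem_plus.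
by rewrite -mulgA plus_mul.
Qed.

Lemma lideal_refl a : lideal a a.
Proof. by exists (plus a) => //; apply: plus_mul. Qed.

(** A generator w = sb = tc of the intersection of Sb and Sc acts as a least
    common left multiple: the solutions of xb = yc are the pairs (zs, zt).  The
    normalization s in Sb^+, t in Sc^+ gives s^+ = w^+ = t^+, which makes the
    domains match. *)
Lemma rho_div_swap b c : LC S ->
  exists s t, rho hS b * sinv (rho hS c) = sinv (rho hS s) * rho hS t.
Proof.
move=> /(_ b c)[w Ew].
have [] : (lideal b `&` lideal c) w by rewrite Ew; apply: lideal_refl.
move=> /lideal_domP[s sb sbw] /lideal_domP[t tc tcw].
have ps : plus s = plus w by rewrite -sbw -plus_mulr sb.
have pt : plus t = plus w by rewrite -tcw -plus_mulr tc.
exists s, t; apply: sym_invP => x y.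
rewrite rho_right_quotE rho_left_quotE ps pt; split.
  move=> [xb yc xy].
  have : lideal w (x * b) by rewrite -Ew; split; [exists x|exists y].
  move=> /lideal_domP[z zw xw]; exists z; split=> //.
    by apply: (mulr_plus_inj (a := b)); rewrite -?mulgA ?sb ?sbw.
  by apply: (mulr_plus_inj (a := c)); rewrite -?mulgA ?tc ?tcw -?xy.
by move=> [z [zw _ -> ->]]; rewrite -!mulgA sb tc sbw tcw.
Qed.

Definition quotients : set (sym_inv S) :=
  [set f | exists a b, f = sinv (rho hS a) * rho hS b].

Lemma quotients_inverse : LC S -> inverse_subsemigroup quotients.
Proof.
move=> lc; split=> [f g [a [b ->]] [c [d ->]]|f [a [b ->]]].
  have [s [t Est]] := rho_div_swap b c lc; exists (s * a), (t * d).
  rewrite -mulgA (mulgA (rho hS b)) Est !rhoM sym_inv_sinvM.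
  by rewrite !mulgA.
by exists b, a; rewrite sym_inv_sinvM sym_inv_sinvK.
Qed.

Lemma rho_quotient a : quotients (rho hS a).
Proof.
exists (plus a), a; apply: sym_invP => x y; rewrite rho_left_quotE rhoE.
have -> : plus (plus a) = plus a by apply: plus_eq; [exact: idem_plus|].
split=> [[xa ->]|[z [za _ -> ->]]]; first by exists x.
by rewrite za.
Qed.

Lemma hull_quotient : LC S -> invgen (range (rho hS)) `<=` quotients.
Proof.
move=> lc f; apply; split; first exact: quotients_inverse.
by move=> _ [a _ <-]; apply: rho_quotient.
Qed.

Lemma left_I_order_of_LC : LC S -> left_I_order (range (theta hS)).
Proof.
move=> lc; split=> [_ _ [a _ <-] [b _ <-]|q].
  by exists (a * b) => //; apply: invgen_val_inj; apply: rhoM.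
have [a [b qab]] := hull_quotient lc (invgen_valP q).
exists (theta hS a), (theta hS b).
by split; [exists a|exists b|apply: invgen_val_inj].
Qed.

Lemma LC_of_left_I_order : left_I_order (range (theta hS)) -> LC S.
Proof.
move=> [_ quo] a b.
have [_ [_ [[c _ <-] [d _ <-] /(congr1 (@invgen_val _ _)) Ecd]]] :=
  quo (theta hS a * sinv (theta hS b)).
have graph x y : [/\ x * plus a = x, y * plus b = y & x * a = y * b] <->
    exists z, [/\ z * plus c = z, z * plus d = z, x = z * c & y = z * d].
  rewrite -rho_right_quotE -rho_left_quotE.
  by rewrite -[X in pgraph X x y <-> _]/(invgen_val
    (theta hS a * sinv (theta hS b))) Ecd.
(* An element is fixed by both c^+ and d^+ exactly when it is fixed by e. *)
pose e := plus c * plus d.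
have ec : e * plus c = e by rewrite /e plusC -mulgA idem_plus.
have ed : e * plus d = e by rewrite /e -mulgA idem_plus.
exists (e * c * a); apply/seteqP; split=> [w [] | _ [x _ <-]].
  move=> /lideal_domP[x xa xw] /lideal_domP[y yb yw].
  have [z [zc zd xz _]] : exists z,
      [/\ z * plus c = z, z * plus d = z, x = z * c & y = z * d].
    by apply/graph; split; rewrite // xw.
  by exists z => //; rewrite -xw xz /e !mulgA zc zd.
have [_ _ ab] : [/\ e * c * plus a = e * c, e * d * plus b = e * d
    & e * c * a = e * d * b] by apply/graph; exists e.
split; first by exists (x * (e * c)); rewrite ?mulgA.
by exists (x * (e * d)) => //; rewrite ab !mulgA.
Qed.

(** Compatibility with left translations passes from the generators to the
    whole hull, and makes an element determined by its value at e when its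
    domain is Se with e idempotent. *)
Definition equivariant : set (sym_inv S) :=
  [set f | forall s x y, pgraph f x y -> pgraph f (s * x) (s * y)].

Lemma hull_equivariant : invgen (range (rho hS)) `<=` equivariant.
Proof.
move=> f; apply; split; last first.
  move=> _ [a _ <-] s x y /rhoE[xa ->]; apply/rhoE.
  by rewrite -mulgA xa mulgA.
split=> [g h eg eh s x y [z gz hz]|g eg s x y]; last exact: eg.
by exists (s * z); [apply: eg|apply: eh].
Qed.

Lemma green_R_dom (f g : inverse_hull hS) x y :
  green_R f g -> pgraph (invgen_val g) x y ->
  exists z, pgraph (invgen_val f) x z.
Proof.
move=> fg gxy; have : range (rmul1 g) g by exists None.
rewrite -fg => -[[u|] _ /= gE]; last by exists y; rewrite gE.
by move: gxy; rewrite -gE => -[z fz _]; exists z.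
Qed.

(** The element b such that f = rho_b is the image of a^+ under f. *)
Lemma green_R_theta a (f : inverse_hull hS) :
  green_R (theta hS a) f -> range (theta hS) f.
Proof.
move=> Raf; have Rfa : green_R f (theta hS a) by [].
have ef := hull_equivariant (invgen_valP f).
have [b fb] : exists b, pgraph (invgen_val f) (plus a) b.
  apply: (green_R_dom (y := plus a * a) Rfa).
  by apply/rhoE; split; [exact: idem_plus|].
(* As f is one-one, xb = yb holds exactly when xa^+ = ya^+. *)
have act1 (x : option S) :
    pgraph (invgen_val f) (lmul1 x (plus a)) (lmul1 x b).
  by case: x => [x|] //=; apply: ef.
have pb : plus b = plus a.
  apply: plus_eq; first exact: idem_plus.
  move=> x y; split=> xy.
    by apply: (pgraph_inj (act1 x)); rewrite xy; apply: act1.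
  by apply: (pgraph_fun (act1 x)); rewrite xy; apply: act1.
have f_act x : x * plus a = x -> pgraph (invgen_val f) x (x * b).
  by move=> xa; have := ef x _ _ fb; rewrite xa.
exists b => //; apply: invgen_val_inj; apply: sym_invP => x y.
rewrite rhoE pb; split=> [[xa ->]|fxy]; first exact: f_act.
have [z /rhoE[xa _]] := green_R_dom Raf fxy.
by split=> //; apply: (pgraph_fun fxy); apply: f_act.
Qed.

Lemma range_theta_union : union_of_R_classes (range (theta hS)).
Proof.
exists [set [set f | green_R g f] | g in range (theta hS)].
  by move=> _ [g _ <-]; exists g.
apply/seteqP; split=> [g rg|f [_ [_ [a _ <-] <-]]]; last exact: green_R_theta.
by exists [set f | green_R g f]; first exists g.
Qed.

End LeftAmple.

Theorem theorem3p7 (S : semigroupType) (hS : left_ample S) :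
  (left_I_order (range (theta hS)) <-> LC S) /\
  (LC S -> union_of_R_classes (range (theta hS))).
Proof.
split; last by move=> _; apply: range_theta_union.
by split; [apply: LC_of_left_I_order|apply: left_I_order_of_LC].
Qed.
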